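(* Let $R$ be an $n$-dimensional rectangle in $\mathbb{R}^n$, let $x\in\mathrm{int}(R)$, and let $\mathcal{P}$ be a minimal locally regulated partition of $R$ about $x$. Then for every nonempty subset $\mathcal{A}\subseteq\mathcal{P}$, the set $\bigcup\mathcal{A}$ is homeomorphic to an $n$-dimensional rectangle in $\mathbb{R}^n$.
   Context: Here $n\ge1$. An $n$-dimensional rectangle in $\mathbb{R}^n$ is a set $\prod_{i=1}^n[a_i,b_i]$ with $a_i<b_i$ for all $i$; its interior is $\prod_i(a_i,b_i)$; its faces are the subsets where one coordinate $y_i$ equals $a_i$ or equals $b_i$. A locally regulated partition of $R$ is a finite set $\mathcal{P}$ of $n$-dimensional rectangles with $\bigcup\mathcal{P}=R$ whose distinct elements have disjoint interiors. It is about $x\in\mathrm{int}(R)$ if for all $P\in\mathcal{P}$ and all faces $F$ of $P$, either $x\in F$ or $F$ is contained in a face of $R$. A standard unit vector $e_i$ is a boundary vector of $x$ with respect to $\mathcal{P}$ if there is $P=\prod_j[a_j,b_j]\in\mathcal{P}$ with $x\in P$ and $x_i\in\{a_i,b_i\}$; $\beta_{\mathcal{P}}(x)$ is the number of boundary vectors of $x$; $\nu_{\mathcal{P}}(x)$ is the number of elements of $\mathcal{P}$ containing $x$. A locally regulated partition $\mathcal{P}$ of $R$ about $x$ is minimal if $\nu_{\mathcal{P}}(x)=\beta_{\mathcal{P}}(x)+1$. *)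

(* Defs.v *)
From HB Require Import structures.
From mathcomp Require Import all_boot all_order all_algebra finmap.
From mathcomp Require Import boolp classical_sets functions reals topology normedtype.

Set Implicit Arguments.
Unset Strict Implicit.
Unset Printing Implicit Defensive.

Import Order.TTheory GRing.Theory Num.Theory.
Import numFieldNormedType.Exports.

Local Open Scope classical_set_scope.
Local Open Scope ring_scope.

(* The rectangle \prod_i [a_i, b_i] is represented by its endpoints (a, b).
   Since a_i < b_i for all i, endpoints and underlying sets determine each
   other, so distinct rectangles are distinct as sets. *)
Record rectangle (R : realType) (n : nat) := Rectangle {
  endpoints : 'rV[R]_n * 'rV[R]_n ;
  _ : [forall i, endpoints.1 0 i < endpoints.2 0 i]
}.

HB.instance Definition _ (R : realType) (n : nat) :=
  [isSub for @endpoints R n].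
HB.instance Definition _ (R : realType) (n : nat) :=
  [Choice of rectangle R n by <:].

Section Rectangles.
Variables (R : realType) (n : nat).
Implicit Types (B P Q : rectangle R n) (x y : 'rV[R]_n).
Implicit Types (Ps : {fset rectangle R n}).

Definition lo B : 'rV[R]_n := (endpoints B).1.
Definition hi B : 'rV[R]_n := (endpoints B).2.

Definition mem_rectangle B : {pred 'rV[R]_n} :=
  fun y => [forall i, lo B 0 i <= y 0 i <= hi B 0 i].

Canonical rectangle_predType := PredType mem_rectangle.

Definition rectangle_int B : set 'rV[R]_n :=
  [set y | forall i, lo B 0 i < y 0 i < hi B 0 i].

Definition is_face B (F : set 'rV[R]_n) : Prop :=
  exists i : 'I_n,
    F = [set y | y \in B /\ y 0 i = lo B 0 i] \/
    F = [set y | y \in B /\ y 0 i = hi B 0 i].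

Definition union_of Ps : set 'rV[R]_n :=
  \bigcup_(P in [set` Ps]) [set` P].

Definition locally_regulated_partition Q Ps : Prop :=
  union_of Ps = [set` Q] /\
  (forall P P', P \in Ps -> P' \in Ps -> P <> P' ->
     rectangle_int P `&` rectangle_int P' = set0).

Definition partition_about Q Ps x : Prop :=
  forall P F, P \in Ps -> is_face P F ->
    F x \/ exists2 G, is_face Q G & F `<=` G.

(* The boundary vector e_i is identified with its index i. *)
Definition boundary_vector Ps x (i : 'I_n) : bool :=
  has (fun P => (x \in P) && ((x 0 i == lo P 0 i) || (x 0 i == hi P 0 i))) Ps.

Definition beta Ps x : nat := #|[pred i | boundary_vector Ps x i]|.

Definition nu Ps x : nat := #|` [fset P in Ps | x \in P]%fset |.

Definition minimal_partition_about Q Ps x : Prop :=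
  [/\ locally_regulated_partition Q Ps,
      partition_about Q Ps x
    & nu Ps x = (beta Ps x + 1)%N].

End Rectangles.

(* A and B carry their subspace topologies; f and g are total functions whose
   values outside A and B are irrelevant. *)
Definition homeomorphic (T U : topologicalType) (A : set T) (B : set U) : Prop :=
  exists (f : T -> U) (g : U -> T),
    [/\ set_fun A B f, set_fun B A g,
        (forall a, A a -> g (f a) = a), (forall b, B b -> f (g b) = b)
      & {within A, continuous f} /\ {within B, continuous g}].

(* Main.v *)
Require Import Defs.
From mathcomp Require Import finmap.
From mathcomp Require Import boolp classical_sets functions reals topology normedtype.
From mathcomp Require Import all_boot all_order all_algebra.
From mathcomp Require Import ring lra zify.

Set Implicit Arguments.
Unset Strict Implicit.
Unset Printing Implicit Defensive.

Import Order.TTheory GRing.Theory Num.Theory.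
Import numFieldNormedType.Exports.

Local Open Scope ring_scope.

(** Every element of the partition contains [x], and in each coordinate [i] it
    is the part below [x], the part above [x], or the full side of [Q].  The
    partition is thus a partition of the discrete cube of sign vectors into
    subcubes, [nu] is the number of subcubes, and [beta] is the number of
    coordinates that some subcube constrains (uses).

    Combinatorics.  A partition into subcubes that uses [k] coordinates has at
    least [k + 1] members: the sign columns of the used coordinates are linearly
    independent (pair a relation with the subcube containing the sign vector of
    its coefficients, [sgn_independent]), and all are orthogonal to the positive
    vector of volumes ([weight_orthogonal]).  When there are exactly [k + 1]
    members, some coordinate constrains all of them ([tight_root]), and the two
    halves that it cuts out are again minimal partitions, using disjoint sets of
    coordinates ([tight_split]).

    Topology.  After translating [x] to the origin, the union of a family of
    subcubes is the intersection of [Q] with a cone [K].  By induction along the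
    splittings, [K] is empty, or everything, or the preimage of a coordinate
    half-space under a positively homogeneous homeomorphism that only involves
    the used coordinates ([tight_cone]).  In the induction step the two halves
    are [t <= 0] with [K0] and [0 <= t] with [K1], and [K0], [K1] depend on
    disjoint sets of coordinates; so they may be straightened simultaneously,
    and it only remains to straighten cones in at most three variables, such as
    the union of [t <= 0, u <= 0] and [0 <= t, v <= 0].  Explicit piecewise
    linear shears do this ([glue_halfspace_like]).

    Finally a homogeneous homeomorphism is rescaled along rays so as to preserve
    the gauge of [Q] centred at [x]; it then carries the union onto the part of
    [Q] on one side of a hyperplane through [x], which is a rectangle
    ([homeomorphic_halfspace_like]). *)

(** * Minimal partitions of the discrete cube into subcubes *)

Lemma exists_linear_dependence (F : fieldType) (S J : finType)
    (A : {set S}) (B : {set J}) (M : S -> J -> F) :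
  (#|B| < #|A|)%N ->
  exists w : S -> F,
    [/\ forall a, a \notin A -> w a = 0,
        exists2 a, a \in A & w a != 0
      & forall b, b \in B -> \sum_(a in A) w a * M a b = 0].
Proof.
move=> ltBA.
pose N : 'M[F]_(#|A|, #|B|) := \matrix_(i, j) M (enum_val i) (enum_val j).
have : kermx N != 0.
  rewrite -mxrank_eq0 mxrank_ker -lt0n subn_gt0.
  by apply: leq_ltn_trans ltBA; apply: rank_leq_col.
case/rowV0Pn=> v /sub_kermxP vN v0.
have [i vi0] : exists i, v 0 i != 0.
  apply/existsP; apply: contraNT v0; rewrite negb_exists => /forallP v0.
  by apply/eqP/rowP=> i; rewrite mxE; apply/eqP; have:= v0 i; rewrite negbK.
have a0 := enum_valP i.
pose w a := if a \in A then v 0 (enum_rank_in a0 a) else 0.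
exists w; split=> [a /negbTE aA|  | b bB].
- by rewrite /w aA.
- exists (enum_val i) => //.
  by rewrite /w a0 enum_valK_in.
- have := congr1 (fun u : 'rV_ _ => u 0 (enum_rank_in bB b)) vN.
  rewrite [RHS]mxE [LHS]mxE => vN0; rewrite big_enum_val /= -[RHS]vN0.
  apply: eq_bigr => k _.
  by rewrite mxE enum_rankK_in // /w enum_valP enum_valK_in.
Qed.

Section Cubes.
Variables (I T : finType) (s : T -> I -> option bool).
Implicit Types (W : {set I}) (C D S : {set T}) (e : {ffun I -> bool}) (b : bool).

Local Notation F := rat.

(** The sign of a boolean, [true] being positive. *)
Definition bsgn b : F := if b then 1 else - 1.

(** A subcube [c] constrains coordinate [i] to the sign [b] when
    [s c i = Some b], and leaves it free when [s c i = None].  [sgn] is the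
    corresponding number in {-1, 0, 1}. *)
Definition sgn (o : option bool) : F := if o is Some b then bsgn b else 0.

(** The sign vector [e] lies in the subcube [c], as far as the coordinates in
    [W] are concerned. *)
Definition agrees W (c : T) e : bool :=
  [forall i in W, s c i != Some (~~ e i)].

(** The restrictions to the coordinates in [W] of the members of [C] partition
    the cube of sign vectors.  Working relative to [W] makes it possible to pass
    to half-cubes without changing the index types. *)
Definition cube_partition W C : Prop :=
  (forall e, exists2 c, c \in C & agrees W c e) /\
  (forall e c d, c \in C -> d \in C -> agrees W c e -> agrees W d e -> c = d).

(** The coordinates in [W] used by some member of [C]. *)
Definition vars W C : {set I} := [set i in W | [exists c in C, s c i != None]].

(** A partition into subcubes with the smallest number of members that its
    number of used coordinates allows, see [card_vars_lt]. *)
Definition tight W C : Prop := cube_partition W C /\ #|C| = #|vars W C|.+1.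

Lemma varsP W C i :
  reflect (i \in W /\ exists2 c, c \in C & s c i != None) (i \in vars W C).
Proof.
rewrite inE; apply: (iffP andP) => [] [iW].
  by case/exists_inP => c cC sc; split => //; exists c.
by case=> c cC sc; split=> //; apply/exists_inP; exists c.
Qed.

Lemma agreesP W c e :
  reflect (forall i, i \in W -> s c i != Some (~~ e i)) (agrees W c e).
Proof. exact: forall_inP. Qed.

Lemma notin_vars W C c i : i \in W -> i \notin vars W C -> c \in C -> s c i = None.
Proof.
move=> iW iV cC; apply/eqP; apply: contraNT iV => sc.
by apply/varsP; split=> //; exists c.
Qed.

Lemma agrees_exists W c : exists e, agrees W c e.
Proof.
exists [ffun i => s c i == Some true].
apply/agreesP=> i _; rewrite ffunE; by case: (s c i) => [[]|].
Qed.

(** The volume of a subcube, up to normalization. *)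
Definition weight W c : F := #|[set e | agrees W c e]|%:R.

Lemma weight_gt0 W c : 0 < weight W c.
Proof.
have [e ae] := agrees_exists W c.
by rewrite /weight ltr0n card_gt0; apply/set0Pn; exists e; rewrite inE.
Qed.

(** The sign vector [e] with the sign of coordinate [i] changed. *)
Definition flip (i : I) e : {ffun I -> bool} :=
  [ffun j => if j == i then ~~ e j else e j].

Lemma flipK i : involutive (flip i).
Proof.
by move=> e; apply/ffunP => j; rewrite !ffunE; case: eqP => // _; rewrite negbK.
Qed.

Lemma sum_bsgn_agrees W c i : i \in W ->
  \sum_(e | agrees W c e) bsgn (e i) = weight W c * sgn (s c i).
Proof.
move=> iW; case sci: (s c i) => [b|] /=.
  rewrite (eq_bigr (fun=> bsgn b)); last first.
    move=> e /agreesP /(_ i iW); rewrite sci; by case: b (e i) {sci} => [] [].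
  rewrite sumr_const -[LHS]mulr_natl; congr (_%:R * _).
  by apply: eq_card => e; rewrite inE.
rewrite mulr0.
set X := LHS; suff: X = - X by lra.
rewrite {1}/X (reindex_inj (inv_inj (flipK i))) /= -sumrN.
apply: eq_big => [e|e _]; last first.
  by rewrite /flip ffunE eqxx /bsgn; case: (e i) => /=; rewrite ?opprK.
apply: eq_forallb => j; rewrite ffunE.
by case: (eqVneq j i) => [->|] //; rewrite sci implybT.
Qed.

(** The sum of a coordinate over all sign vectors vanishes, and it can be
    computed subcube by subcube. *)
Lemma weight_orthogonal W C i : cube_partition W C -> i \in W ->
  \sum_(c in C) weight W c * sgn (s c i) = 0.
Proof.
move=> [ex un] iW.
under eq_bigr => c _ do rewrite -sum_bsgn_agrees //.
rewrite (exchange_big_dep predT) //=.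
rewrite (eq_bigr (fun e : {ffun I -> bool} => bsgn (e i))); last first.
  move=> e _; have [c cC ce] := ex e.
  rewrite (bigD1 c) ?cC //= big1 ?addr0 // => d /andP[/andP[dC de] dc].
  by rewrite (un e d c) ?eqxx in dc.
set X := LHS; suff: X = - X by lra.
rewrite {1}/X (reindex_inj (inv_inj (flipK i))) /= -sumrN.
by apply: eq_bigr => e _; rewrite ffunE eqxx /bsgn; case: (e i); rewrite ?opprK.
Qed.

(** A sign vector [e'] that agrees with the signs of the coefficients of a
    linear relation makes all terms of that relation nonnegative in the subcube
    containing [e'], so that they vanish there: this subcube uses no coordinate
    with a nonzero coefficient.  As [e'] is arbitrary at the other coordinates,
    every subcube occurs in this way. *)
Lemma sgn_independent W C (l : I -> F) : cube_partition W C ->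
  (forall c, c \in C -> \sum_(i in vars W C) l i * sgn (s c i) = 0) ->
  forall i, i \in vars W C -> l i = 0.
Proof.
move=> [ex un] l0 i iV; apply/eqP; apply: contraT => li.
have [iW [c cC /eqP sc]] := varsP _ _ _ iV.
have [e ce] := agrees_exists W c.
pose e' : {ffun I -> bool} :=
  [ffun j => if (j \in vars W C) && (l j != 0) then 0 < l j else e j].
have [d dC de'] := ex e'.
have dN j : j \in vars W C -> l j != 0 -> s d j = None.
  move=> jV lj.
  have ge0 k : k \in vars W C -> 0 <= l k * sgn (s d k).
    move=> kV; have [-> | lk] := eqVneq (l k) 0; first by rewrite mul0r.
    have [kW _] := varsP _ _ _ kV.
    have /agreesP/(_ _ kW) := de'; rewrite ffunE kV lk /=.
    case: (s d k) => [[]|] /=; rewrite ?mulr0 ?mulr1 ?mulrN1 //.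
      by case: ltP lk => //= /ltW.
    by rewrite oppr_ge0; case: ltP.
  have /(psumr_eq0P ge0) /(_ _ jV) /eqP := l0 _ dC.
  rewrite mulf_eq0 (negbTE lj) /=.
  by case: (s d j) => [[]|] //=; rewrite ?oppr_eq0 oner_eq0.
have de : agrees W d e.
  apply/agreesP=> j jW; have /agreesP/(_ j jW) := de'; rewrite ffunE.
  by case: ifP => // /andP[jV lj]; rewrite dN.
by case: sc; rewrite (un e c d) // dN.
Qed.

Lemma partition_neq0 W C : cube_partition W C -> exists c, c \in C.
Proof. by case=> ex _; have [c cC _] := ex [ffun=> true]; exists c. Qed.

Lemma sum_mulr_eq0_at S (w f : T -> F) a : \sum_(c in S) w c * f c = 0 ->
  a \in S -> w a != 0 -> (forall c, c \in S -> c != a -> f c = 0) -> f a = 0.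
Proof.
move=> + aS wa f0; rewrite (bigD1 a) //= [X in _ + X]big1 => [|c /andP[cS ca]].
  by rewrite addr0 => /eqP; rewrite mulf_eq0 (negbTE wa) => /eqP.
by rewrite f0 ?mulr0.
Qed.

Lemma sum_mulr_lincomb S (w : T -> F) (V : {set I}) (l : I -> F) :
  (forall i, i \in V -> \sum_(c in S) w c * sgn (s c i) = 0) ->
  \sum_(c in S) w c * (\sum_(i in V) l i * sgn (s c i)) = 0.
Proof.
move=> w0; under eq_bigr => c _ do rewrite big_distrr /=.
rewrite exchange_big /= big1 // => i iV.
under eq_bigr => c _ do rewrite mulrCA.
by rewrite -big_distrr /= w0 ?mulr0.
Qed.

Lemma card_vars_lt W C : cube_partition W C -> (#|vars W C| < #|C|)%N.
Proof.
move=> pC; have [c0 c0C] := partition_neq0 pC.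
rewrite ltnNge; apply/negP=> leCV.
have lt : (#|C :\ c0| < #|vars W C|)%N.
  by move: leCV; rewrite (cardsD1 c0) c0C.
have [l [_ [i iV li] l0]] :=
  exists_linear_dependence (fun i c => sgn (s c i)) lt.
case/eqP: li; apply: (sgn_independent pC _ iV) => c cC.
have [->|cc0] := eqVneq c c0; last by apply: l0; rewrite !inE cc0.
apply: (sum_mulr_eq0_at (w := weight W)
  (f := fun c => \sum_(i in vars W C) l i * sgn (s c i))
  (sum_mulr_lincomb _ _) c0C).
- by move=> j /varsP[jW _]; apply: weight_orthogonal.
- by rewrite gt_eqF ?weight_gt0.
- by move=> d dC dc0; apply: l0; rewrite !inE dc0.
Qed.

(** In a tight partition the sign columns span the orthogonal complement of the
    volumes.  As volumes are positive, this complement projects onto the space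
    of all functions on a proper subfamily [S], so that no nonzero [w] supported
    on [S] is orthogonal to all the sign columns. *)
Lemma tight_proper_independent W C S (w : T -> F) : tight W C -> S \proper C ->
  (forall i, i \in vars W S -> \sum_(c in S) w c * sgn (s c i) = 0) ->
  forall c, c \in S -> w c = 0.
Proof.
move=> [pC cardC] /properP[SC [c0 c0C c0S]] w0 d dS.
apply/eqP; apply: contraT => wd.
have dC := subsetP SC _ dS.
have dc0 : d != c0 by apply: contraNneq c0S => <-.
have lt : (#|C :\ c0 :\ d| < #|vars W C|)%N.
  rewrite -ltnS -cardC.
  by rewrite (cardsD1 c0 C) c0C (cardsD1 d (C :\ c0)) !inE dc0 dC.
have [l [_ [i iV li] l0]] :=
  exists_linear_dependence (fun i c => sgn (s c i)) lt.
case/eqP: li; apply: (sgn_independent pC _ iV).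
pose f c := \sum_(i in vars W C) l i * sgn (s c i).
have fd : f d = 0.
  apply: (sum_mulr_eq0_at (w := w) (f := f) (sum_mulr_lincomb _ _) dS wd).
    move=> j /varsP[jW _]; have [jS|jS] := boolP (j \in vars W S); first exact: w0.
    by rewrite big1 // => c cS; rewrite (notin_vars jW jS cS) /= mulr0.
  move=> c cS cd; apply: l0; rewrite !inE cd (subsetP SC) // andbT.
  by apply: contraNneq c0S => <-.
move=> c cC.
have [->//|cd] := eqVneq c d.
have [->|cc0] := eqVneq c c0; last by apply: l0; rewrite !inE cd cc0.
apply: (sum_mulr_eq0_at (w := weight W) (f := f) (sum_mulr_lincomb _ _) c0C).
- by move=> j /varsP[jW _]; apply: weight_orthogonal.
- by rewrite gt_eqF ?weight_gt0.
- move=> a aC ac0; have [->//|ad] := eqVneq a d.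
  by apply: l0; rewrite !inE ac0 ad.
Qed.

(** The members of [C] that meet the half-cube where coordinate [i] has sign
    [b]. *)
Definition face_cubes b i C : {set T} := [set c in C | s c i != Some (~~ b)].

Lemma face_partition W C b i : cube_partition W C -> i \in W ->
  cube_partition (W :\ i) (face_cubes b i C).
Proof.
move=> [ex un] iW.
pose set_i e : {ffun I -> bool} := [ffun j => if j == i then b else e j].
have agreesE c e : s c i != Some (~~ b) ->
    agrees (W :\ i) c e -> agrees W c (set_i e).
  move=> sc /agreesP ce; apply/agreesP => j jW; rewrite ffunE.
  by case: (eqVneq j i) => [->//|ji]; apply: ce; rewrite !inE ji.
split=> [e|e c d].
  have [c cC /agreesP ce] := ex (set_i e); exists c.
    by rewrite !inE cC; have := ce _ iW; rewrite ffunE eqxx.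
  apply/agreesP=> j; rewrite !inE => /andP[/negbTE ji jW].
  by have := ce _ jW; rewrite ffunE ji.
rewrite !inE => /andP[cC ci] /andP[dC di] ce de.
by apply: (un (set_i e)) => //; apply: agreesE.
Qed.

(** The members of [C] that do not constrain coordinate [i]. *)
Definition free_cubes i C : {set T} := [set c in C | s c i == None].

Lemma card_faces i C :
  (#|face_cubes false i C| + #|face_cubes true i C| = #|C| + #|free_cubes i C|)%N.
Proof.
rewrite -cardsUI; congr (_ + _)%N; apply: eq_card => c; rewrite !inE.
  by case: (c \in C); case: (s c i) => [[]|].
by case: (c \in C); case: (s c i) => [[]|].
Qed.

Lemma vars_faces W C i : i \in vars W C ->
  vars W C = i |: (vars (W :\ i) (face_cubes false i C) :|:
                   vars (W :\ i) (face_cubes true i C)).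
Proof.
move=> iV; have [iW _] := varsP _ _ _ iV.
apply/setP=> j; rewrite in_setU1; have [->//|ji] := eqVneq j i.
apply/idP/idP => /=.
  case/varsP=> jW [c cC sc]; rewrite in_setU; apply/orP.
  have [sci|sci] := eqVneq (s c i) (Some true); [right|left];
    (apply/varsP; split; [by rewrite !inE ji|exists c => //]);
    by rewrite !inE cC ?sci.
by case/setUP=> /varsP[/setD1P[_ jW] [c /setIdP[cC _] sc]];
  apply/varsP; split=> //; exists c.
Qed.

Lemma card_vars_faces W C i : i \in vars W C ->
  (#|vars W C| + #|vars (W :\ i) (face_cubes false i C) :&:
                   vars (W :\ i) (face_cubes true i C)|
   = (#|vars (W :\ i) (face_cubes false i C)| +
      #|vars (W :\ i) (face_cubes true i C)|).+1)%N.
Proof.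
move=> iV; rewrite -[in RHS]cardsUI.
have /(congr1 (fun V : {set I} => #|V|)) /= -> := vars_faces iV.
by rewrite cardsU1 !inE eqxx /= add1n addSn.
Qed.

(** Splitting a tight partition by a coordinate that constrains every subcube. *)
Lemma tight_split W C i : tight W C -> i \in vars W C -> free_cubes i C = set0 ->
  [/\ tight (W :\ i) (face_cubes false i C), tight (W :\ i) (face_cubes true i C)
    & [disjoint vars (W :\ i) (face_cubes false i C)
              & vars (W :\ i) (face_cubes true i C)]].
Proof.
move=> [pC cC] iV wi; have [iW _] := varsP _ _ _ iV.
have pC0 := face_partition false pC iW; have pC1 := face_partition true pC iW.
have lt0 := card_vars_lt pC0; have lt1 := card_vars_lt pC1.
have := card_faces i C; rewrite wi cards0 => cf.
have := card_vars_faces iV => cv.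
split; [split=> //; lia|split=> //; lia|].
by rewrite -setI_eq0 -cards_eq0; apply/eqP; lia.
Qed.

(** The sign columns used by a proper subfamily [S] of a tight partition span
    the functions on [S]. *)
Lemma card_vars_proper W C S : tight W C -> S \proper C -> (#|S| <= #|vars W S|)%N.
Proof.
move=> tC SC; rewrite leqNgt; apply/negP=> lt.
have [w [_ [c cS wc] w0]] := exists_linear_dependence (fun c i => sgn (s c i)) lt.
by case/eqP: wc; apply: (tight_proper_independent tC SC).
Qed.

(** Two sign columns that are constant on [S] are proportional there, so that
    one of them can be dropped in [card_vars_proper]. *)
Lemma card_vars_proper_parallel W C S (j k : I) (a b : bool) :
  tight W C -> S \proper C -> j \in vars W S -> k \in vars W S -> j != k ->
  (forall c, c \in S -> s c j = Some a) -> (forall c, c \in S -> s c k = Some b) ->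
  (#|S| < #|vars W S|)%N.
Proof.
move=> tC SC jV kV jk sj sk; rewrite (cardsD1 k) kV add1n ltnS leqNgt.
apply/negP=> lt.
have [w [_ [c cS wc] w0]] := exists_linear_dependence (fun c i => sgn (s c i)) lt.
case/eqP: wc; apply: (tight_proper_independent tC SC) cS => i iV.
have [->|ik] := eqVneq i k; last by apply: w0; apply/setD1P.
have : \sum_(c in S) w c * sgn (s c j) = 0 by apply: w0; apply/setD1P.
rewrite (eq_bigr (fun c => w c * bsgn a)); last by move=> d dS; rewrite sj.
move=> wa; rewrite (eq_bigr (fun c => w c * bsgn b)); last first.
  by move=> d dS; rewrite sk.
move: wa; rewrite -!big_distrl /= => /eqP; rewrite mulf_eq0 => /orP[/eqP->|].
  by rewrite mul0r.
by case: (a); rewrite /= ?oppr_eq0 oner_eq0.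
Qed.

(** The two halves cut out by [j] use disjoint sets of coordinates, hence
    subcubes that all use [k] lie in the same half. *)
Lemma root_constant_sign W C S j k : tight W C -> j \in vars W C ->
  free_cubes j C = set0 -> S \subset C -> j != k -> k \in W ->
  (forall c, c \in S -> s c k != None) -> S != set0 ->
  exists a, forall c, c \in S -> s c j = Some a.
Proof.
move=> tC jV wj SC jk kW sk /set0Pn[d dS].
have sj c : c \in S -> s c j != None.
  move=> cS; apply/negP=> sc; have : c \in free_cubes j C.
    by rewrite inE (subsetP SC).
  by rewrite wj inE.
have [_ _ dis] := tight_split tC jV wj.
have kface c a : c \in S -> s c j = Some a -> k \in vars (W :\ j) (face_cubes a j C).
  move=> cS sc; apply/varsP; split; first by rewrite !inE eq_sym jk.
  by exists c; rewrite ?sk // !inE sc (subsetP SC) //; case: (a).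
case sd: (s d j) (sj d dS) => [a|//] _; exists a => c cS.
case sc: (s c j) (sj c cS) => [b|//] _; congr Some.
have [kc kd] := (kface _ _ cS sc, kface _ _ dS sd).
have H b1 b2 : k \in vars (W :\ j) (face_cubes b1 j C) ->
   k \in vars (W :\ j) (face_cubes b2 j C) -> b1 = b2.
  case: b1 b2 => [] [] // k1 k2; move/pred0P: dis => /(_ k) /=;
  by rewrite k1 k2.
exact: H kc kd.
Qed.

(** If the family [S] of subcubes not constraining a used coordinate [i] is not
    empty, then counting shows that both halves cut out by [i] are tight and that
    [S] has exactly as many members as it uses coordinates.  By induction the halves
    have coordinates [j] and [k] that constrain all their members; if these
    differ, they have constant signs on [S], against
    [card_vars_proper_parallel]. *)
Theorem tight_root W C : tight W C -> vars W C != set0 ->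
  exists2 i, i \in vars W C & free_cubes i C = set0.
Proof.
elim: {W}_.+1 {-2}W (ltnSn #|W|) C => // m IH W; rewrite ltnS => leWm C tC.
case/set0Pn=> i iV; have [iW [c0 c0C c0i]] := varsP _ _ _ iV.
pose S := free_cubes i C.
have [S0|S0] := eqVneq S set0; first by exists i.
have [pC cC] := tC.
have SC : S \proper C.
  apply/properP; split; first by apply/subsetP => c /setIdP[].
  by exists c0; rewrite // inE c0C.
pose V b := vars (W :\ i) (face_cubes b i C).
have ltV b : (#|V b| < #|face_cubes b i C|)%N by apply/card_vars_lt/face_partition.
have cf := card_faces i C; have cv := card_vars_faces iV.
have cS := card_vars_proper tC SC.
have Sface b : S \subset face_cubes b i C.
  by apply/subsetP => c; rewrite !inE => /andP[-> /eqP ->].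
have VS b : vars W S \subset V b.
  apply/subsetP => j /varsP[jW [c cSc sc]]; apply/varsP; split.
    rewrite !inE jW andbT; apply: contraNneq sc => ->.
    by have := cSc; rewrite inE => /andP[].
  by exists c; rewrite ?(subsetP (Sface b)).
have VSI : (#|vars W S| <= #|V false :&: V true|)%N.
  by apply/subset_leq_card/subsetIP; split; apply: VS.
have [ltF ltT] := (ltV false, ltV true).
have tight_face b : tight (W :\ i) (face_cubes b i C).
  split; first exact: face_partition.
  by rewrite /V /S in ltF ltT VSI cS *; case: b; lia.
have cSV : #|S| = #|vars W S| by rewrite /V /S in ltF ltT VSI cS *; lia.
have [c cSc] := set0Pn _ S0.
have [i0 i0V] : exists i0, i0 \in vars W S.
  apply/set0Pn; rewrite -card_gt0 -cSV card_gt0; exact: S0.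
have V0 b : V b != set0 by apply/set0Pn; exists i0; apply: (subsetP (VS b)).
have root b := IH (W :\ i) _ _ (tight_face b) (V0 b).
have ltW : (#|W :\ i| < m)%N by move: leWm; rewrite (cardsD1 i) iW.
have [j jV wj] := root ltW false; have [k kV wk] := root ltW true.
have rS l b : free_cubes l (face_cubes b i C) = set0 ->
    forall d, d \in face_cubes b i C -> s d l != None.
  move=> wl d dF; apply/negP=> sd; have : d \in free_cubes l (face_cubes b i C).
    by rewrite inE dF.
  by rewrite wl inE.
have sj d : d \in S -> s d j != None.
  by move=> dS; apply: (rS j false) => //; apply: (subsetP (Sface false)).
have sk d : d \in S -> s d k != None.
  by move=> dS; apply: (rS k true) => //; apply: (subsetP (Sface true)).
have [/setD1P[_ jW] _] := varsP _ _ _ jV.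
have [/setD1P[_ kW] _] := varsP _ _ _ kV.
have jVS : j \in vars W S by apply/varsP; split=> //; exists c; rewrite ?sj.
have kVS : k \in vars W S by apply/varsP; split=> //; exists c; rewrite ?sk.
have [jk|jk] := eqVneq j k.
  exists j.
    by rewrite (vars_faces iV) in_setU1 in_setU jV orbT.
  apply/setP=> d; rewrite [RHS]inE; apply/negP => /setIdP[dC].
  have [dF|] := boolP (d \in face_cubes false i C); first exact/negP/(rS j false).
  rewrite inE dC negbK => /eqP sd; apply/negP; rewrite jk.
  by apply: (rS k true) => //; rewrite inE dC sd.
have [kWi jWi] : k \in W :\ i /\ j \in W :\ i.
  by case/varsP: jV => ? _; case/varsP: kV => ? _.
have [a sja] := root_constant_sign (tight_face false) jV wj (Sface _) jk kWi sk S0.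
have [b skb] : exists b, forall c, c \in S -> s c k = Some b.
  by apply: (root_constant_sign (tight_face true) kV wk (Sface _) _ jWi sj S0);
    rewrite eq_sym.
have := card_vars_proper_parallel tC SC jVS kVS jk sja skb.
by rewrite -cSV ltnn.
Qed.
End Cubes.

(** * Homogeneous homeomorphisms and cones *)

(** For real [s] and [d] let [c s d] be [(|s + d| - |s - d|) / 2], which is [s]
    clamped to the interval between [- |d|] and [|d|], times the sign of [d].  In
    the coordinates [s = u + v] and [d = v - u], the boundary of the union on the
    left is, for fixed [d], a step: it is [s = d] for [t < 0], [s = - d] for
    [0 < t], and these two parts are joined along [t = 0].  Replacing [t] by
    [t' = t - c s d = t + |u| - |v|] tilts the joining part and makes the
    boundary the graph [s = - c t' d].  The number [w] below is [d / 2], so that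
    [c t' d = |t' / 2 + w| - |t' / 2 - w|]. *)
Lemma two_bricks_sign (R : realFieldType) (t u v : R) :
  let t' := t + (`|u| + (-1) * `|v|) in
  let w := v + (- 2^-1) * (u + v) in
  (t <= 0 /\ u <= 0) \/ (0 <= t /\ v <= 0) <->
  u + v + (`|2^-1 * t' + w| + (-1) * `|2^-1 * t' + (-1) * w|) <= 0.
Proof.
move=> t' w; rewrite {}/t' {}/w.
case: (ler0P u) => hu; case: (ler0P v) => hv; (split; last first).
1,3,5,7: case: (ltgtP t 0) => ht; do 2 case: ger0P => ?; move=> ?;
   first [lra | left; split; lra | right; split; lra].
all: case=> -[? ?]; do 2 case: ger0P => ?; lra.
Qed.

Local Open Scope classical_set_scope.

Section Cones.
Variables (R : realType) (n : nat).
Local Notation E := 'rV[R]_n.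
Implicit Types (y z : E) (V W : {set 'I_n}) (h : E -> E) (K : set E).

Lemma cvg_coord (T : Type) (F : set_system T) (FF : Filter F) (f : T -> E) y :
  (forall j, (fun t => f t 0 j) @ F --> y 0 j) -> f @ F --> y.
Proof.
move=> fj A [P Py PA].
apply: (@filterS _ F _ [set t | forall j, P 0 j (f t 0 j)]).
  by move=> t Pt; apply: PA => i j; rewrite ord1; apply: Pt.
by apply: filter_forall => j; apply: fj; apply: Py.
Qed.

Lemma continuous_coord (T : topologicalType) (f : T -> E) :
  (forall j, continuous (fun t => f t 0 j)) -> continuous f.
Proof. by move=> fj y; apply: (@cvg_coord _ (nbhs y)) => j; exact: fj. Qed.

(** A continuous positively homogeneous function that depends only on the
    coordinates in [D]. *)
Definition cone_function (D : {set 'I_n}) (g : E -> R) : Prop :=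
  [/\ continuous g,
      forall a y, 0 <= a -> g (a *: y) = a * g y
    & forall y z, (forall j, j \in D -> y 0 j = z 0 j) -> g y = g z].

Lemma cone_function_coord (D : {set 'I_n}) j : j \in D ->
  cone_function D (fun y => y 0 j).
Proof.
move=> jD; split=> [|a y _|y z]; first exact: coord_continuous.
  by rewrite mxE.
exact.
Qed.

Lemma cone_functionD D g1 g2 : cone_function D g1 -> cone_function D g2 ->
  cone_function D (fun y => g1 y + g2 y).
Proof.
move=> [c1 h1 l1] [c2 h2 l2]; split=> [y|a y a0|y z yz].
- exact: (cvgD (c1 y) (c2 y)).
- by rewrite h1 // h2 // mulrDr.
- by rewrite (l1 y z) // (l2 y z).
Qed.

Lemma cone_functionZ D c g : cone_function D g ->
  cone_function D (fun y => c * g y).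
Proof.
move=> [cg hg lg]; split=> [y|a y a0|y z yz].
- exact: (cvgM (cvg_cst c) (cg y)).
- by rewrite hg // mulrCA.
- by rewrite (lg y z).
Qed.

Lemma cone_function_norm D g : cone_function D g ->
  cone_function D (fun y => `|g y|).
Proof.
move=> [cg hg lg]; split=> [y|a y a0|y z yz].
- exact: (cvg_norm (cg y)).
- by rewrite hg // normrM ger0_norm.
- by rewrite (lg y z).
Qed.

(** A positively homogeneous self-homeomorphism of the whole space that fixes
    the coordinates outside [V], and whose coordinates in [V] depend only on
    the coordinates in [V]. *)
Definition cone_homeomorphism V h : Prop :=
  [/\ continuous h, exists g, [/\ cancel h g, cancel g h & continuous g],
      forall a y, 0 <= a -> h (a *: y) = a *: h y,
      forall y j, j \notin V -> h y 0 j = y 0 j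
    & forall y z, (forall j, j \in V -> y 0 j = z 0 j) ->
        forall j, j \in V -> h y 0 j = h z 0 j].

Lemma cone_homeomorphism_id V : cone_homeomorphism V id.
Proof.
have cid : continuous (id : E -> E) by move=> y; exact: cvg_id.
by split=> //; exists id.
Qed.

Lemma cone_homeomorphism_comp V h k :
  cone_homeomorphism V h -> cone_homeomorphism V k ->
  cone_homeomorphism V (fun y => k (h y)).
Proof.
move=> [ch [h' [hK h'K ch']] hh sh lh] [ck [k' [kK k'K ck']] hk sk lk].
split=> [y||a y a0|y j jV|y z yz].
- exact: (continuous_comp (ch y) (ck (h y))).
- exists (fun y => h' (k' y)); split=> [y|y|y]; rewrite ?kK ?h'K //.
  exact: (continuous_comp (ck' y) (ch' (k' y))).
- by rewrite hh // hk.
- by rewrite sk // sh.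
- by apply: lk; apply: lh.
Qed.

Lemma cone_homeomorphism_sub V W h : V \subset W ->
  cone_homeomorphism V h -> cone_homeomorphism W h.
Proof.
move=> /subsetP VW [ch ih hh sh lh]; split=> // [y j jW|y z yz j jW].
  by apply: sh; apply: contraNN jW; apply: VW.
have [jV|jV] := boolP (j \in V); last by rewrite !sh ?yz.
by apply: lh => // k kV; apply: yz; apply: VW.
Qed.

(** Addition of [g] to coordinate [i]. *)
Definition shear (i : 'I_n) (g : E -> R) y : E :=
  \row_j (if j == i then y 0 j + g y else y 0 j).

Lemma shear_continuous i g : continuous g -> continuous (shear i g).
Proof.
move=> cg; apply: continuous_coord => j.
rewrite (_ : (fun y => _) = fun y => if j == i then y 0 j + g y else y 0 j).
  case: eqP => _ y; last exact: coord_continuous.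
  exact: (cvgD (@coord_continuous _ _ _ 0 j y) (cg y)).
by apply/funext=> y; rewrite mxE.
Qed.

Lemma cone_homeomorphism_shear V i g : i \in V -> cone_function (V :\ i) g ->
  cone_homeomorphism V (shear i g).
Proof.
move=> iV [cg hg lg].
have gE y z : (forall j, j != i -> y 0 j = z 0 j) -> g y = g z.
  by move=> yz; apply: lg => j /setD1P[ji _]; apply: yz.
split=> [||a y a0|y j jV|y z yz j jV].
- exact: shear_continuous.
- exists (shear i (fun y => - g y)).
  split=> [y|y|]; last by apply: shear_continuous => y; exact: (cvgN (cg y)).
  + have gs : g (shear i g y) = g y by apply: gE => j /negbTE ji; rewrite mxE ji.
    by apply/rowP=> j; rewrite !mxE gs; case: eqP => // _; rewrite addrK.
  + have gs : g (shear i (fun y => - g y) y) = g y.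
      by apply: gE => j /negbTE ji; rewrite mxE ji.
    by apply/rowP=> j; rewrite !mxE gs; case: eqP => // _; rewrite subrK.
- by apply/rowP=> j; rewrite !mxE hg //; case: eqP => // _; rewrite mulrDr.
- by rewrite mxE; case: eqP => // ji; rewrite ji iV in jV.
- rewrite !mxE (lg y z) ?yz // => k /setD1P[_ kV]; exact: yz.
Qed.

(** Change of sign of coordinate [i]. *)
Definition reflection (i : 'I_n) y : E :=
  \row_j (if j == i then - y 0 j else y 0 j).

Lemma cone_homeomorphism_reflection V i : i \in V ->
  cone_homeomorphism V (reflection i).
Proof.
move=> iV.
have rK : involutive (reflection i).
  by move=> y; apply/rowP=> j; rewrite !mxE; case: eqP => // _; rewrite opprK.
have rc : continuous (reflection i).
  apply: continuous_coord => j.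
  rewrite (_ : (fun y => _) = fun y => if j == i then - y 0 j else y 0 j).
    case: eqP => _ y; last exact: coord_continuous.
    exact: (cvgN (@coord_continuous _ _ _ 0 j y)).
  by apply/funext=> y; rewrite mxE.
split=> // [|a y _|y j jV|y z yz j jV].
- by exists (reflection i).
- by apply/rowP=> j; rewrite !mxE; case: eqP => // _; rewrite mulrN.
- by rewrite mxE; case: eqP => // ji; rewrite ji iV in jV.
- by rewrite !mxE yz.
Qed.

(** The cone [K] can be straightened to a coordinate half-space by a
    homeomorphism that involves the coordinates in [V] only. *)
Definition halfspace_like V K : Prop :=
  exists2 h, cone_homeomorphism V h &
    exists2 j, j \in V & forall y, K y <-> h y 0 j <= 0.

(** The sign condition is the one obtained after adding [a] times coordinate [j]
    to coordinate [i], then a combination of the new coordinate [i] and its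
    absolute value to coordinate [j]. *)
Lemma halfspace_like_shear V K h i j (a b c : R) :
  cone_homeomorphism V h -> i \in V -> j \in V -> i != j ->
  (forall y, K y <->
     h y 0 j + (b * (h y 0 i + a * h y 0 j) + c * `|h y 0 i + a * h y 0 j|) <= 0) ->
  halfspace_like V K.
Proof.
move=> hV iV jV ij KE.
exists (fun y => shear j (fun z => b * z 0 i + c * `|z 0 i|)
                  (shear i (fun z => a * z 0 j) (h y))).
  apply: cone_homeomorphism_comp.
    apply: cone_homeomorphism_comp hV _; apply: cone_homeomorphism_shear => //.
    by apply/cone_functionZ/cone_function_coord; rewrite !inE eq_sym ij.
  apply: cone_homeomorphism_shear => //.
  by apply: cone_functionD; apply: cone_functionZ;
    try (apply: cone_function_norm); apply: cone_function_coord; rewrite !inE ij.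
exists j => // y; rewrite KE !mxE !eqxx.
by rewrite eq_sym (negbTE ij).
Qed.

(** The union of two quarter-spaces lying on opposite sides of [t = 0]; near the
    origin its boundary is not the graph of a function in any direction, so
    that several shears are needed. *)
Lemma halfspace_like_two_bricks V K h i j k :
  cone_homeomorphism V h -> i \in V -> j \in V -> k \in V ->
  i != j -> i != k -> j != k ->
  (forall y, K y <-> (h y 0 i <= 0 /\ h y 0 j <= 0) \/
                     (0 <= h y 0 i /\ h y 0 k <= 0)) ->
  halfspace_like V K.
Proof.
move=> hV iV jV kV ij ik jk KE.
(* Coordinates [i], [j], [k] become in turn [t'], [u + v] and [(v - u) / 2]; then
   [g4] adds to [u + v] the clamping term of [two_bricks_sign]. *)
pose g1 := fun z : E => `|z 0 j| + (-1) * `|z 0 k|.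
pose g2 := fun z : E => z 0 k.
pose g3 := fun z : E => (- 2^-1) * z 0 j.
pose g4 := fun z : E => `|2^-1 * z 0 i + z 0 k| + (-1) * `|2^-1 * z 0 i + (-1) * z 0 k|.
exists (fun y => shear j g4 (shear k g3 (shear j g2 (shear i g1 (h y))))).
  apply: cone_homeomorphism_comp; last first.
    apply: cone_homeomorphism_shear => //.
    apply: cone_functionD; last apply: cone_functionZ;
      apply: cone_function_norm; apply: cone_functionD; try apply: cone_functionZ;
      by apply: cone_function_coord; rewrite !inE ?ij // eq_sym jk.
  apply: cone_homeomorphism_comp; last first.
    apply: cone_homeomorphism_shear => //.
    by apply: cone_functionZ; apply: cone_function_coord; rewrite !inE jk.
  apply: cone_homeomorphism_comp; last first.
    apply: cone_homeomorphism_shear => //.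
    by apply: cone_function_coord; rewrite !inE eq_sym jk.
  apply: cone_homeomorphism_comp => //.
  apply: cone_homeomorphism_shear => //.
  apply: cone_functionD; last apply: cone_functionZ;
    apply: cone_function_norm; by apply: cone_function_coord;
    rewrite !inE eq_sym ?ij ?ik.
exists j => // y; rewrite KE /g4 /g3 /g2 /g1 !mxE !eqxx.
have -> : (j == i) = false by rewrite eq_sym (negbTE ij).
have -> : (k == i) = false by rewrite eq_sym (negbTE ik).
have -> : (k == j) = false by rewrite eq_sym (negbTE jk).
rewrite (negbTE ij) (negbTE ik) (negbTE jk).
exact: two_bricks_sign.
Qed.

(** The three possible shapes of a union of cones of a tight partition. *)
Definition trivial_or_halfspace_like V K : Prop :=
  [\/ forall y, ~ K y, forall y, K y | halfspace_like V K].

Lemma halfspace_like_coord V K (i : 'I_n) : i \in V ->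
  (forall y, K y <-> y 0 i <= 0) -> halfspace_like V K.
Proof. by move=> iV KE; exists id; [exact: cone_homeomorphism_id|exists i]. Qed.

Lemma halfspace_like_coordN V K (i : 'I_n) : i \in V ->
  (forall y, K y <-> 0 <= y 0 i) -> halfspace_like V K.
Proof.
move=> iV KE; exists (reflection i); first exact: cone_homeomorphism_reflection.
by exists i => // y; rewrite mxE eqxx KE oppr_le0.
Qed.

(** Gluing two cones along the hyperplane where coordinate [i] vanishes. *)
Lemma glue_halfspace_like V0 V1 W (i : 'I_n) (K0 K1 K : set E) :
  V0 \subset W -> V1 \subset W -> i \in W -> i \notin V0 -> i \notin V1 ->
  (forall l, l \in V0 -> l \notin V1) ->
  trivial_or_halfspace_like V0 K0 -> trivial_or_halfspace_like V1 K1 ->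
  (forall y, K y <-> (y 0 i <= 0 /\ K0 y) \/ (0 <= y 0 i /\ K1 y)) ->
  trivial_or_halfspace_like W K.
Proof.
move=> V0W V1W iW iV0 iV1 V01 K0h K1h KE.
have hi V h y : i \notin V -> cone_homeomorphism V h -> h y 0 i = y 0 i.
  by move=> iV [_ _ _ sh _]; rewrite sh.
have ne V j : i \notin V -> j \in V -> i != j.
  by move=> iV jV; apply: contraNneq iV => ->.
case: K0h => [K0E|K0E|[h0 h0V [j jV0 K0E]]];
  case: K1h => [K1E|K1E|[h1 h1V [k kV1 K1E]]].
- by apply: Or31 => y /KE[[_ /K0E]|[_ /K1E]].
- apply: Or33; apply: (halfspace_like_coordN iW) => y; rewrite KE.
  by split=> [[[_ /K0E//]|[]//]|]; right.
- (* [0 <= t] and [v <= 0]: add to [v] the positive part of [- t - v]. *)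
  apply: Or33; have h1W := cone_homeomorphism_sub V1W h1V.
  apply: (@halfspace_like_shear W K h1 i k 1 (- 2^-1) (2^-1) h1W iW
    (subsetP V1W _ kV1) (ne _ _ iV1 kV1)) => y.
  rewrite KE K1E (hi _ _ _ iV1 h1V).
  have -> : (y 0 i <= 0 /\ K0 y \/ 0 <= y 0 i /\ h1 y 0 k <= 0) <->
            (0 <= y 0 i /\ h1 y 0 k <= 0).
    by split=> [[[_ /K0E]|]//|]; right.
  by move: (y 0 i) (h1 y 0 k) => t v; case: (ger0P (t + 1 * v)) => ?;
    split=> [[? ?]|?]; [|split| |split]; lra.
- apply: Or33; apply: (halfspace_like_coord iW) => y; rewrite KE.
  by split=> [[[]//|[_ /K1E//]]|]; left.
- apply: Or32 => y; rewrite KE.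
  by case: (lerP (y 0 i) 0) => [|/ltW]; [left|right].
- (* [t <= 0] or [v <= 0]: add to [v] the negative part of [t - v]. *)
  apply: Or33; have h1W := cone_homeomorphism_sub V1W h1V.
  apply: (@halfspace_like_shear W K h1 i k (-1) (2^-1) (- 2^-1) h1W iW
    (subsetP V1W _ kV1) (ne _ _ iV1 kV1)) => y.
  rewrite KE K1E (hi _ _ _ iV1 h1V).
  have -> : (y 0 i <= 0 /\ K0 y \/ 0 <= y 0 i /\ h1 y 0 k <= 0) <->
            (y 0 i <= 0 \/ h1 y 0 k <= 0).
    have K0y := K0E y; split; first by case=> [[]|[]]; [left|right].
    by case: (lerP (y 0 i) 0) => [?|/ltW ?] [] ?; [left|left|left|right].
  move: (y 0 i) (h1 y 0 k) => t v; case: (ger0P (t + -1 * v)) => ?; split=> [[]?|?]; lra.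
- (* [t <= 0] and [u <= 0]: add to [u] the positive part of [t - u]. *)
  apply: Or33; have h0W := cone_homeomorphism_sub V0W h0V.
  apply: (@halfspace_like_shear W K h0 i j (-1) (2^-1) (2^-1) h0W iW
    (subsetP V0W _ jV0) (ne _ _ iV0 jV0)) => y.
  rewrite KE K0E (hi _ _ _ iV0 h0V).
  have -> : (y 0 i <= 0 /\ h0 y 0 j <= 0 \/ 0 <= y 0 i /\ K1 y) <->
            (y 0 i <= 0 /\ h0 y 0 j <= 0).
    by split=> [[|[_ /K1E]]//|]; left.
  by move: (y 0 i) (h0 y 0 j) => t u; case: (ger0P (t + -1 * u)) => ?;
    split=> [[? ?]|?]; [|split| |split]; lra.
- (* [0 <= t] or [u <= 0]: add to [u] the negative part of [- t - u]. *)
  apply: Or33; have h0W := cone_homeomorphism_sub V0W h0V.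
  apply: (@halfspace_like_shear W K h0 i j 1 (- 2^-1) (- 2^-1) h0W iW
    (subsetP V0W _ jV0) (ne _ _ iV0 jV0)) => y.
  rewrite KE K0E (hi _ _ _ iV0 h0V).
  have -> : (y 0 i <= 0 /\ h0 y 0 j <= 0 \/ 0 <= y 0 i /\ K1 y) <->
            (0 <= y 0 i \/ h0 y 0 j <= 0).
    have K1y := K1E y; split; first by case=> [[]|[]]; [right|left].
    by case: (lerP 0 (y 0 i)) => [?|/ltW ?] [] ?; [right|right|right|left].
  move: (y 0 i) (h0 y 0 j) => t u; case: (ger0P (t + 1 * u)) => ?; split=> [[]?|?]; lra.
- (* Disjointness of [V0] and [V1] makes the composite straighten both cones. *)
  apply: Or33.
  have h0W := cone_homeomorphism_sub V0W h0V.
  have h1W := cone_homeomorphism_sub V1W h1V.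
  have kV0 : k \notin V0.
    by apply: contraTN kV1; apply: V01.
  have jk : j != k by apply: contraNneq kV0 => <-.
  apply: (@halfspace_like_two_bricks W K (fun y => h1 (h0 y)) i j k _ iW
    (subsetP V0W _ jV0) (subsetP V1W _ kV1)
    (ne _ _ iV0 jV0) (ne _ _ iV1 kV1) jk) => [|y].
    exact: cone_homeomorphism_comp.
  rewrite KE K0E K1E (hi _ _ _ iV1 h1V) (hi _ _ _ iV0 h0V).
  have [_ _ _ sh0 _] := h0V; have [_ _ _ sh1 lh1] := h1V.
  have -> : h1 (h0 y) 0 j = h0 y 0 j.
    by rewrite sh1 // V01.
  have -> // : h1 (h0 y) 0 k = h1 y 0 k.
  apply: lh1 => // l lV1; rewrite sh0 //.
  by apply: contraTN lV1; apply: V01.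
Qed.

End Cones.

Section ConeOfCubes.
Variables (R : realType) (n : nat) (T : finType) (s : T -> 'I_n -> option bool).
Local Notation E := 'rV[R]_n.
Implicit Types (W : {set 'I_n}) (A C : {set T}).

(** The real number [r] satisfies the sign constraint [o], in the weak sense. *)
Definition sign_ok (o : option bool) (r : R) : Prop :=
  if o is Some b then (if b then 0 <= r else r <= 0) else True.

(** The union of the closed cones of the subcubes in [A], disregarding
    constraints on coordinates outside [W]. *)
Definition cone_of W A : set E :=
  [set y | exists2 c, c \in A & forall i, i \in W -> sign_ok (s c i) (y 0 i)].

(** The tree of successive splittings of a tight partition straightens all its
    unions of cones. *)
Theorem tight_cone W C A : tight s W C -> A \subset C ->
  trivial_or_halfspace_like (vars s W C) (cone_of W A).
Proof.
elim: {W}_.+1 {-2}W (ltnSn #|W|) C A => // m IH W; rewrite ltnS => leWm C A tC.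
move=> /subsetP AC.
have [V0|V0] := eqVneq (vars s W C) set0.
  have [A0|[c cA]] := set_0Vmem A.
    by apply: Or31 => y [c]; rewrite A0 inE.
  apply: Or32 => y; exists c => // i iW.
  by rewrite (notin_vars iW _ (AC c cA)) // V0 inE.
have [i iV wi] := tight_root tC V0.
have [t0 t1 V01] := tight_split tC iV wi.
have [iW _] := varsP _ _ _ _ iV.
have ltW : (#|W :\ i| < m)%N by move: leWm; rewrite (cardsD1 i) iW.
have sub b : A :&: face_cubes s b i C \subset face_cubes s b i C.
  by apply: subsetIr.
have K0 := IH _ ltW _ _ t0 (sub false).
have K1 := IH _ ltW _ _ t1 (sub true).
have VE := vars_faces iV.
apply: (glue_halfspace_like _ _ iV _ _ _ K0 K1).
- by rewrite VE setUA subsetU // subsetUr.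
- by rewrite VE setUA subsetUr.
- by apply/negP => /varsP[]; rewrite !inE eqxx.
- by apply/negP => /varsP[]; rewrite !inE eqxx.
- by move=> l l0; move/pred0P: V01 => /(_ l) /=; rewrite l0 => /= ->.
have root c : c \in A -> exists b, s c i = Some b.
  move=> cA; case sc: (s c i) => [b|]; first by exists b.
  have : c \in free_cubes s i C by rewrite inE (AC c cA) sc.
  by rewrite wi inE.
have up b y : (cone_of (W :\ i) (A :&: face_cubes s b i C)) y ->
    sign_ok (Some b) (y 0 i) -> cone_of W A y.
  move=> [c /setIP[cA]]; rewrite inE => /andP[_ sc] cy yi.
  exists c => // j jW; have [->|ji] := eqVneq j i; last first.
    by apply: cy; rewrite !inE ji.
  by have [b' sb'] := root c cA; move: sc yi; rewrite sb'; case: (b) (b') => [] [].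
move=> y; split=> [[c cA cy]|]; last first.
  by case=> -[yi cy]; [apply: (up false y cy)|apply: (up true y cy)].
have [b sb] := root c cA; have := cy i iW; rewrite sb => yi.
have cone_b : cone_of (W :\ i) (A :&: face_cubes s b i C) y.
  exists c; first by rewrite !inE cA (AC c cA) sb /=; case: (b).
  by move=> j /setD1P[_ jW]; apply: cy.
by case: (b) yi cone_b => ? ?; [right|left].
Qed.
End ConeOfCubes.

(** * Rescaling along rays *)

Section Radial.
Variables (R : realType) (n : nat).
Local Notation E := 'rV[R]_n.

(** The properties of the gauge of a bounded convex neighbourhood of the origin
    that are needed to rescale along rays. *)
Definition gauge_like (r : E -> R) : Prop :=
  [/\ continuous r, forall a y, 0 <= a -> r (a *: y) = a * r y,
      forall y, y != 0 -> 0 < r y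
    & exists2 M, 0 <= M & forall y, `|y| <= M * r y].

(** The map [h] rescaled along rays so as to preserve [r].  At the origin the
    quotient is [0 / 0 = 0], and the value is the origin when [r] and [h] are
    homogeneous. *)
Definition radial (r : E -> R) (h : E -> E) (y : E) : E :=
  (r y / r (h y)) *: h y.

Variables (r : E -> R) (hr : gauge_like r).

Lemma gauge0 : r 0 = 0.
Proof. by have [_ h _ _] := hr; have := h 0 0 (lexx 0); rewrite scale0r mul0r. Qed.

Lemma gauge_ge0 y : 0 <= r y.
Proof.
have [_ _ p _] := hr; have [->|/p/ltW//] := eqVneq y 0; by rewrite gauge0.
Qed.

Variables (h g : E -> E).
Hypotheses (hg : cancel h g) (gh : cancel g h).
Hypotheses (hh : forall a y, 0 <= a -> h (a *: y) = a *: h y).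

Lemma homogeneous0 : h 0 = 0.
Proof. by have := hh 0 (lexx 0); rewrite !scale0r. Qed.

Lemma homogeneous_neq0 y : y != 0 -> h y != 0.
Proof.
apply: contraNneq => hy0; apply/eqP.
by rewrite -[LHS]hg hy0 -[in LHS]homogeneous0 hg.
Qed.

Lemma gauge_radial y : r (radial r h y) = r y.
Proof.
have [_ rh rp _] := hr; rewrite /radial rh ?divr_ge0 ?gauge_ge0 //.
have [->|y0] := eqVneq y 0; first by rewrite homogeneous0 gauge0 mulr0.
by rewrite divfK // gt_eqF // rp // homogeneous_neq0.
Qed.

(** Away from the origin the formula is continuous; at the origin, preservation
    of [r] bounds the norm of the image. *)
Lemma radial_continuous : continuous h -> continuous (radial r h).
Proof.
move=> ch y; have [rc rh rp [M M0 rM]] := hr.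
have [->|y0] := eqVneq y 0.
  rewrite /continuous_at /radial homogeneous0 scaler0.
  apply/(@cvgr0Pnorm_lt _ _ _ (nbhs (0 : E))) => e e0.
  have /(@cvgr0Pnorm_lt _ _ _ (nbhs (0 : E)))/(_ (e / (M + 1))) :
    r z @[z --> (0 : E)] --> (0 : R).
    by rewrite -[X in _ --> X]gauge0; exact: rc.
  rewrite divr_gt0 ?ltr_wpDl // => /(_ isT); apply: filterS => z.
  rewrite ger0_norm ?gauge_ge0 // ltr_pdivlMr ?ltr_wpDl // => rz.
  apply: le_lt_trans (rM _) _; rewrite -/(radial r h z) gauge_radial.
  apply: le_lt_trans rz; rewrite mulrC ler_wpM2l ?gauge_ge0 // lerDl //.
have rhy : r (h y) != 0 by rewrite gt_eqF // rp // homogeneous_neq0.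
have cV := cvgV rhy (continuous_comp (ch y) (rc (h y))).
exact: (cvgZ (cvgM (rc y) (cV _)) (ch y)).
Qed.
End Radial.

Lemma radialK (R : realType) (n : nat) (r : 'rV[R]_n -> R) (h g : 'rV[R]_n -> 'rV[R]_n) :
  gauge_like r -> cancel h g -> cancel g h ->
  (forall a y, 0 <= a -> h (a *: y) = a *: h y) ->
  cancel (radial r h) (radial r g).
Proof.
move=> hr hg gh hh y.
have [_ rh rp _] := hr.
have ghom a z : 0 <= a -> g (a *: z) = a *: g z.
  by move=> a0; rewrite -[z in LHS]gh -hh // hg.
have [->|y0] := eqVneq y 0.
  by rewrite /radial (homogeneous0 hh) scaler0 (homogeneous0 ghom) scaler0.
rewrite {1}/radial (gauge_radial hr hg hh).
have hy0 := homogeneous_neq0 hg hh y0.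
have c0 : 0 < r y / r (h y) by rewrite divr_gt0 // rp.
rewrite /radial ghom ?ltW // hg rh ?ltW // scalerA.
rewrite [X in X *: _](_ : _ = 1) ?scale1r //.
have ry : r y != 0 by rewrite gt_eqF // rp.
have rhy : r (h y) != 0 by rewrite gt_eqF // rp.
by field; rewrite ry rhy.
Qed.

Lemma rV_norm_leP (R : realType) n (v : 'rV[R]_n) (c : R) : 0 <= c ->
  (`|v| <= c) <-> (forall i, `|v 0 i| <= c).
Proof.
move=> c0; have -> : `|v| = \big[Num.max/0]_ij `|v ij.1 ij.2| := mx_normrE v.
split=> [/bigmax_leP[_ vc] i|vc].
  exact: (vc (0, i)).
by apply/bigmax_leP; split=> // -[i j] _; rewrite ord1.
Qed.

Section Gauge.
Variables (R : realType) (n : nat) (Q : rectangle R n) (x : 'rV[R]_n).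
Hypothesis hx : rectangle_int Q x.
Local Notation E := 'rV[R]_n.

Lemma mem_rectangleP (P : rectangle R n) (y : E) :
  reflect (forall i, lo P 0 i <= y 0 i <= hi P 0 i) (y \in P).
Proof. exact: forallP. Qed.

(** The gauge of the interval [[lo - x, hi - x]] in each coordinate, that is
    the maximum of [y / (hi - x)] and [- y / (x - lo)], written with an absolute
    value so that continuity and homogeneity follow from the closure properties
    of [cone_function]. *)
Definition gauge_row (y : E) : E := \row_i
  ((2^-1 * ((hi Q 0 i - x 0 i)^-1 - (x 0 i - lo Q 0 i)^-1)) * y 0 i +
   (2^-1 * ((hi Q 0 i - x 0 i)^-1 + (x 0 i - lo Q 0 i)^-1)) * `|y 0 i|).

(** The gauge of [Q - x]. *)
Definition gauge (y : E) : R := `|gauge_row y|.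

Lemma gauge_rowE y i : gauge_row y 0 i =
  if 0 <= y 0 i then y 0 i / (hi Q 0 i - x 0 i)
  else - y 0 i / (x 0 i - lo Q 0 i).
Proof.
rewrite mxE; have half2 (r : R) : 2^-1 * r + 2^-1 * r = r by lra.
set a := (hi _ _ _ - _)^-1; set b := (x _ _ - _)^-1.
by case: ger0P => _; [rewrite -[RHS]half2|rewrite -[RHS]half2]; ring.
Qed.

Lemma gauge_row_ge0 y i : 0 <= gauge_row y 0 i.
Proof.
have /andP[? ?] := hx i; rewrite gauge_rowE.
by case: (lerP 0 (y 0 i)) => y0; rewrite divr_ge0 ?oppr_ge0 ?subr_ge0 // ltW.
Qed.

Lemma gauge_le1 y : gauge y <= 1 <-> y + x \in Q.
Proof.
rewrite /gauge rV_norm_leP //; split=> [yl|/mem_rectangleP yQ i].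
  apply/mem_rectangleP => i; have /andP[l h] := hx i; rewrite mxE.
  have := yl i; rewrite ger0_norm ?gauge_row_ge0 // gauge_rowE.
  by case: (lerP 0 (y 0 i)) => y0; rewrite ler_pdivrMr ?subr_gt0 // => ?; lra.
have /andP[l h] := hx i; have := yQ i; rewrite mxE.
rewrite ger0_norm ?gauge_row_ge0 // gauge_rowE => /andP[? ?].
by case: (lerP 0 (y 0 i)) => y0; rewrite ler_pdivrMr ?subr_gt0 //; lra.
Qed.

(** The bound on the norm is by the widths of [Q]. *)
Lemma gauge_gauge_like : gauge_like gauge.
Proof.
have coord i : cone_function [set i]%SET (fun y : E => gauge_row y 0 i).
  rewrite (_ : (fun y => _) = fun y : E =>
   (2^-1 * ((hi Q 0 i - x 0 i)^-1 - (x 0 i - lo Q 0 i)^-1)) * y 0 i +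
   (2^-1 * ((hi Q 0 i - x 0 i)^-1 + (x 0 i - lo Q 0 i)^-1)) * `|y 0 i|).
    by apply: cone_functionD; apply: cone_functionZ;
      try apply: cone_function_norm; apply: cone_function_coord; rewrite inE.
  by apply/funext => y; rewrite mxE.
split=> [y|a y a0|y y0|].
- have cr : continuous gauge_row.
    by apply: continuous_coord => i; have [] := coord i.
  exact: (cvg_norm (cr y)).
- rewrite /gauge (_ : gauge_row (a *: y) = a *: gauge_row y).
    by rewrite normrZ ger0_norm.
  by apply/rowP=> i; have [_ hi _] := coord i; rewrite hi // [RHS]mxE.
- rewrite normr_gt0; apply: contraNneq y0 => g0; apply/eqP/rowP => i.
  have := congr1 (fun v : E => v 0 i) g0; rewrite gauge_rowE !mxE.
  have /andP[l h] := hx i.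
  by case: (lerP 0 (y 0 i)) => _ /eqP; rewrite mulf_eq0 invr_eq0 subr_eq0;
    rewrite (gt_eqF l, gt_eqF h) orbF ?oppr_eq0 => /eqP.
exists `|hi Q - lo Q| => [//|y].
have gy0 : 0 <= gauge y by apply: normr_ge0.
apply/rV_norm_leP => [|i]; first exact: mulr_ge0.
apply: (@le_trans _ _ ((hi Q 0 i - lo Q 0 i) * gauge_row y 0 i)).
  have /andP[l h] := hx i; rewrite gauge_rowE.
  have p0 : 0 < hi Q 0 i - x 0 i by rewrite subr_gt0.
  have q0 : 0 < x 0 i - lo Q 0 i by rewrite subr_gt0.
  case: (lerP 0 (y 0 i)) => y0; rewrite mulrA ler_pdivlMr //.
    by rewrite ger0_norm // mulrC ler_wpM2r //; lra.
  by rewrite ltr0_norm // mulrC ler_wpM2r //; lra.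
have /andP[l h] := hx i.
apply: ler_pM; rewrite ?gauge_row_ge0 //; first by lra.
  have /rV_norm_leP := lexx `|hi Q - lo Q|.
  by move=> /(_ (normr_ge0 _) i); apply: le_trans; rewrite !mxE ler_norm.
have /rV_norm_leP := lexx (gauge y).
by move=> /(_ gy0 i); apply: le_trans; rewrite ler_norm.
Qed.

Lemma half_rectangle_subproof (j : 'I_n) :
  [forall i, (lo Q, \row_k (if k == j then x 0 k else hi Q 0 k) : E).1 0 i <
             (lo Q, \row_k (if k == j then x 0 k else hi Q 0 k) : E).2 0 i].
Proof.
apply/forallP => i /=; rewrite mxE; have /andP[l h] := hx i.
by case: eqP => // _; apply: lt_trans h.
Qed.

(** The part of [Q] where coordinate [j] is at most that of [x]. *)
Definition half_rectangle j : rectangle R n := Rectangle (half_rectangle_subproof j).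

Lemma half_rectangleP j y : y + x \in half_rectangle j <-> gauge y <= 1 /\ y 0 j <= 0.
Proof.
rewrite gauge_le1; split.
  move/mem_rectangleP => yC; split.
    apply/mem_rectangleP => i; have := yC i; rewrite /lo /hi !mxE /= => /andP[-> /=].
    have /andP[_ h] := hx i.
    by case: eqP => // _ /le_trans; apply; apply: ltW.
  have := yC j; rewrite /lo /hi !mxE /= eqxx => /andP[_]; lra.
move=> [/mem_rectangleP yQ yj]; apply/mem_rectangleP => i.
have := yQ i; rewrite /lo /hi !mxE /= => /andP[-> h] /=.
by case: eqP => // ->; lra.
Qed.

(** The straightening homeomorphism of [K], rescaled so as to preserve the gauge,
    carries [U] onto a half of [Q]. *)
Lemma homeomorphic_halfspace_like V (K U : set E) : halfspace_like V K ->
  (forall y, U (y + x) <-> gauge y <= 1 /\ K y) ->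
  exists C : rectangle R n, homeomorphic U [set` C].
Proof.
move=> [h [ch [g [hg gh cg]] hh _ _] [j _ KE]] UE; exists (half_rectangle j).
have gg := gauge_gauge_like.
have ghom a z : 0 <= a -> g (a *: z) = a *: g z.
  by move=> a0; rewrite -[z in LHS]gh -hh // hg.
have c0 y z : 0 <= gauge y / gauge z by rewrite divr_ge0 // (gauge_ge0 gg).
have ct (k : E -> E) : continuous k -> continuous (fun y : E => k (y - x) + x).
  move=> ck y.
  have cs : (fun z : E => z - x) z @[z --> y] --> y - x.
    exact: (cvgB (@cvg_id _ _) (cvg_cst x)).
  exact: (cvgD (continuous_comp cs (ck (y - x))) (cvg_cst x)).
exists (fun y : E => radial gauge h (y - x) + x),
  (fun y : E => radial gauge g (y - x) + x).
split.
- move=> y; rewrite -[y in U y](subrK x) => /UE[y1 /KE yj].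
  apply/half_rectangleP; rewrite (gauge_radial gg hg hh); split=> //.
  by rewrite mxE mulr_ge0_le0.
- move=> y; rewrite /= -[X in X \in _](subrK x) => /half_rectangleP[y1 yj].
  apply/UE; rewrite (gauge_radial gg gh ghom); split=> //.
  by apply/KE; rewrite hh // gh mxE mulr_ge0_le0.
- by move=> y _; rewrite addrK (radialK gg hg gh hh) subrK.
- by move=> y _; rewrite addrK (radialK gg gh hg ghom) subrK.
- split; apply: continuous_subspaceT; apply: ct.
    exact: (radial_continuous gg hg hh ch).
  exact: (radial_continuous gg gh ghom cg).
Qed.
End Gauge.

(** * Partitions of a rectangle about a point *)

Section Partition.
Variables (R : realType) (n : nat) (Q : rectangle R n) (x : 'rV[R]_n).
Variable (Ps : {fset rectangle R n}).
Hypothesis hx : rectangle_int Q x.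
Hypothesis lrp : locally_regulated_partition Q Ps.
Hypothesis about : partition_about Q Ps x.
Local Notation E := 'rV[R]_n.

Lemma lo_lt_hi (P : rectangle R n) i : lo P 0 i < hi P 0 i.
Proof. by case: P => p pP; apply: (forallP pP). Qed.

Lemma rectangle_in_box P y : P \in Ps -> y \in P -> y \in Q.
Proof.
move=> PP yP; have [cov _] := lrp.
have : union_of Ps y by exists P.
by rewrite cov.
Qed.

Lemma lo_mem (P : rectangle R n) : lo P \in P.
Proof. by apply/mem_rectangleP => i; rewrite lexx ltW ?lo_lt_hi. Qed.

Lemma hi_mem (P : rectangle R n) : hi P \in P.
Proof. by apply/mem_rectangleP => i; rewrite lexx ltW ?lo_lt_hi. Qed.

(** A facet of [P] orthogonal to the axis [i] has positive width along all other
    axes, so that a face of [Q] containing it is also orthogonal to the axis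
    [i]. *)
Lemma face_subset_coord (P : rectangle R n) (F G : set E) i v :
  F = [set y | y \in P /\ y 0 i = v] -> lo P 0 i <= v <= hi P 0 i ->
  is_face Q G -> F `<=` G -> v = lo Q 0 i \/ v = hi Q 0 i.
Proof.
move=> FE vP [j Gj] FG.
pose p (w : E) : E := \row_k if k == i then v else w 0 k.
have pF w : w \in P -> F (p w).
  move=> /mem_rectangleP wP; rewrite FE; split; last by rewrite mxE eqxx.
  by apply/mem_rectangleP => k; rewrite mxE; case: eqP => // ->.
have [c cG cj] : exists2 c, forall y, G y -> y 0 j = c & c = lo Q 0 j \/ c = hi Q 0 j.
  case: Gj => ->; [exists (lo Q 0 j)|exists (hi Q 0 j)] => //; try by move=> y [].
    by left.
  by right.
have pc w : w \in P -> p w 0 j = c by move=> wP; apply/cG/FG/pF.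
have ji : j = i.
  apply/eqP/negP => ji; have := lo_lt_hi P j.
  have := pc _ (lo_mem P); have := pc _ (hi_mem P).
  rewrite !mxE (negbTE (introN idP ji)) => -> ->; by rewrite ltxx.
by move: cj; rewrite -(pc _ (lo_mem P)) mxE ji eqxx.
Qed.

Lemma about_lo P i : P \in Ps ->
  (x \in P /\ x 0 i = lo P 0 i) \/ lo P 0 i = lo Q 0 i.
Proof.
move=> PP; have /about -/(_ PP) : is_face P [set y | y \in P /\ y 0 i = lo P 0 i].
  by exists i; left.
case=> [[? ?]|[G Gf FG]]; [by left|right].
have [//|e] : lo P 0 i = lo Q 0 i \/ lo P 0 i = hi Q 0 i.
  by apply: (face_subset_coord erefl _ Gf FG); rewrite lexx ltW ?lo_lt_hi.
have /mem_rectangleP/(_ i)/andP[_] := rectangle_in_box PP (hi_mem P).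
by rewrite -e leNgt lo_lt_hi.
Qed.

Lemma about_hi P i : P \in Ps ->
  (x \in P /\ x 0 i = hi P 0 i) \/ hi P 0 i = hi Q 0 i.
Proof.
move=> PP; have /about -/(_ PP) : is_face P [set y | y \in P /\ y 0 i = hi P 0 i].
  by exists i; right.
case=> [[? ?]|[G Gf FG]]; [by left|right].
have [e|//] : hi P 0 i = lo Q 0 i \/ hi P 0 i = hi Q 0 i.
  by apply: (face_subset_coord erefl _ Gf FG); rewrite lexx ltW ?lo_lt_hi.
have /mem_rectangleP/(_ i)/andP[+ _] := rectangle_in_box PP (lo_mem P).
by rewrite -e leNgt lo_lt_hi.
Qed.

(** An element of the partition that avoids [x] would have all its faces in those
    of [Q], hence would be [Q] itself. *)
Lemma mem_center P : P \in Ps -> x \in P.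
Proof.
move=> PP; apply/mem_rectangleP => i; have /andP[l h] := hx i.
case: (about_lo i PP) => [[/mem_rectangleP//]|->].
case: (about_hi i PP) => [[/mem_rectangleP/(_ i)/andP[_ ->]]|->]; rewrite ?ltW //.
Qed.

(** The place of [P] with respect to [x] along the axis [i]: above ([Some true]),
    below ([Some false]), or on both sides ([None]). *)
Definition position (P : rectangle R n) (i : 'I_n) : option bool :=
  if lo P 0 i == x 0 i then Some true
  else if hi P 0 i == x 0 i then Some false else None.

Lemma positionP P i : P \in Ps ->
  match position P i with
  | Some true => lo P 0 i = x 0 i /\ hi P 0 i = hi Q 0 i
  | Some false => lo P 0 i = lo Q 0 i /\ hi P 0 i = x 0 i
  | None => lo P 0 i = lo Q 0 i /\ hi P 0 i = hi Q 0 i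
  end.
Proof.
move=> PP; rewrite /position; have lh := lo_lt_hi P i.
have Lo : lo P 0 i != x 0 i -> lo P 0 i = lo Q 0 i.
  by case: (about_lo i PP) => [[_ ->]|]; rewrite ?eqxx.
have Hi : hi P 0 i != x 0 i -> hi P 0 i = hi Q 0 i.
  by case: (about_hi i PP) => [[_ ->]|]; rewrite ?eqxx.
case: eqP => [e|/eqP/Lo e]; first by split=> //; apply: Hi; rewrite -e gt_eqF.
by case: eqP => [//|/eqP/Hi].
Qed.

Lemma mem_position P y : P \in Ps ->
  y + x \in P <-> y + x \in Q /\ forall i, sign_ok (position P i) (y 0 i).
Proof.
move=> PP; split=> [yP|[/mem_rectangleP yQ ys]].
  split=> [|i]; first exact: rectangle_in_box yP.
  have /mem_rectangleP/(_ i) := yP; rewrite mxE.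
  have := positionP i PP; case: position => [[]|] //= [-> ->] /andP[]; lra.
apply/mem_rectangleP => i; have := yQ i; have := ys i; rewrite mxE.
have /andP[] := hx i.
by have := positionP i PP; case: position => [[]|] //= [-> ->] ? ? ? /andP[? ?];
  apply/andP; split; lra.
Qed.

Let s (P : Ps) i := position (val P) i.

(** Each sign vector [e] is represented by a point [pt e] of [Q] that is strictly
    on the side prescribed by [e] along every axis; the element of the partition
    containing it has it in its interior. *)
Lemma position_partition : cube_partition s setT setT.
Proof.
pose pt (e : {ffun 'I_n -> bool}) : E :=
  \row_i if e i then 2^-1 * (hi Q 0 i + x 0 i) else 2^-1 * (lo Q 0 i + x 0 i).
have ptQ e i : lo Q 0 i < pt e 0 i < hi Q 0 i /\
    (if e i then x 0 i < pt e 0 i else pt e 0 i < x 0 i).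
  by have /andP[l h] := hx i; rewrite mxE; case: (e i);
    split; rewrite ?(introT andP) //; try split; lra.
have ptP e (P : Ps) : agrees s setT P e <-> rectangle_int (val P) (pt e).
  split=> [/agreesP ag i|pi].
    have := ag i (in_setT i); have [/andP[l h]] := ptQ e i.
    rewrite /s; have := positionP i (valP P).
    by case: position => [[]|] [-> ->]; case: (e i) => // ? _; apply/andP; split.
  apply/agreesP=> i _; have [_] := ptQ e i; have /andP[] := pi i.
  rewrite /s; have := positionP i (valP P).
  by case: position => [[]|] [-> ->]; case: (e i) => // ? ? ?; lra.
split=> [e|e P P' _ _ /ptP a /ptP a'].
  have [cov _] := lrp.
  have : union_of Ps (pt e).
    rewrite cov; apply/mem_rectangleP => i.
    by have [/andP[l h] _] := ptQ e i; rewrite !ltW.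
  case=> P PP /mem_rectangleP yP; exists [` PP]%fset; first exact: in_setT.
  apply/ptP => i /=; have := yP i; have [/andP[l h] o] := ptQ e i.
  have /andP[] := hx i; move: (positionP i PP) o.
  by case: position => [[]|] [-> ->]; case: (e i) => ? ? ? /andP[? ?];
    apply/andP; split; lra.
have [_ dis] := lrp; apply: val_inj; apply: contrapT => PP'.
have := dis _ _ (valP P) (valP P') PP'.
by move/seteqP => [/(_ (pt e)) + _]; apply.
Qed.

Lemma tight_position : nu Ps x = (beta Ps x + 1)%N -> tight s setT setT.
Proof.
move=> numin; split; first exact: position_partition.
rewrite cardsT; have -> : #|{: Ps}| = nu Ps x.
  rewrite -cardfE /nu; congr #|` _|.
  apply/fsetP => P; rewrite !classical_sets.inE /=.
  by case PP: (P \in Ps) => //=; rewrite mem_center.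
rewrite numin addn1 /beta; congr _.+1; apply: eq_card => i.
rewrite [LHS]classical_sets.inE; apply/idP/idP.
  case/hasP => P PP /andP[xP xi]; apply/varsP; split; first exact: in_setT.
  exists [` PP]%fset; first exact: in_setT.
  rewrite /s /position /= ![_ == x 0 i]eq_sym.
  by case/orP: xi => ->; case: (x 0 i == lo P 0 i).
case/varsP => _ [P _ sP]; apply/hasP; exists (val P); first exact: valP.
rewrite mem_center ?valP //=; move: sP; rewrite /s /position ![_ == x 0 i]eq_sym.
by case: (x 0 i == lo _ 0 i); case: (x 0 i == hi _ 0 i).
Qed.

Lemma union_position (As : {fset rectangle R n}) y : (As `<=` Ps)%fset ->
  union_of As (y + x) <->
  gauge Q x y <= 1 /\
  cone_of s setT [set P : Ps | val P \in As]%SET y.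
Proof.
move=> AsPs; rewrite (gauge_le1 hx); split.
  case=> P PA yP; have PP := fsubsetP AsPs _ PA.
  have [yQ sy] := (mem_position y PP).1 yP; split=> //.
  by exists [` PP]%fset => [|i _]; [rewrite inE|exact: sy].
case=> yQ [P]; rewrite inE => PA sy; exists (val P) => //.
apply/(mem_position y (valP P)); split=> // i; apply: sy; exact: in_setT.
Qed.
End Partition.

Theorem theorem3p10 (R : realType) (n : nat) (hn : (1 <= n)%N)
    (Q : rectangle R n) (x : 'rV[R]_n) (hx : rectangle_int Q x)
    (Ps : {fset rectangle R n}) (hPs : minimal_partition_about Q Ps x)
    (As : {fset rectangle R n}) (hAs : (As `<=` Ps)%fset)
    (hAs0 : As <> fset0) :
  exists C : rectangle R n, homeomorphic (union_of As) [set` C].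
Proof.
have [lrp about mini] := hPs.
have UE y := union_position hx lrp about y hAs.
have tP := tight_position hx lrp about mini.
have := @tight_cone R _ _ _ _ _ _ tP (subsetT [set P : Ps | val P \in As]%SET).
case=> [K0|KT|]; last by move=> Kh; apply: (homeomorphic_halfspace_like hx Kh UE).
- have /fset0Pn [P PA] : As != fset0 by apply/eqP.
  have PP := fsubsetP hAs _ PA.
  have : union_of As (0 + x).
    by exists P => //=; rewrite add0r; apply: (mem_center hx lrp about).
  by case/UE => _ /K0.
- exists Q; rewrite (_ : union_of As = [set` Q]).
    exists id, id; split=> //; split; apply: continuous_subspaceT => y; exact: cvg_id.
  apply/seteqP; split=> y /=; rewrite -(subrK x y).
    by move/UE => [/(gauge_le1 hx)].
  by move=> yQ; apply/UE; split=> //; apply/(gauge_le1 hx).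
Qed.
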